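(* Let $\underline{Q}$ be a lower transition rate operator on $\mathcal{L}(\mathcal{X})$. Then $\underline{Q}$ is ergodic if and only if there is some $n<|\mathcal{X}|$ such that $\rho(\Phi(\delta_1,\dots,\delta_k))<1$ for one (and then all) $k\geq n$ and one (and then all) sequence(s) $\delta_1,\dots,\delta_k$ in $\mathbb{R}_{>0}$ such that $\delta_i\|\underline{Q}\|<2$ for all $i\in\{1,\dots,k\}$. That is, the following three statements are equivalent: (a) $\underline{Q}$ is ergodic; (b) there is an integer $0\le n<|\mathcal{X}|$ such that for all integers $k\geq n$ with $k\ge1$ and all $\delta_1,\dots,\delta_k\in\mathbb{R}_{>0}$ with $\delta_i\|\underline{Q}\|<2$ for all $i\in\{1,\dots,k\}$, $\rho(\Phi(\delta_1,\dots,\delta_k))<1$; (c) there are an integer $0\le n<|\mathcal{X}|$, an integer $k\geq n$ with $k\ge1$, and $\delta_1,\dots,\delta_k\in\mathbb{R}_{>0}$ with $\delta_i\|\underline{Q}\|<2$ for all $i\in\{1,\dots,k\}$, such that $\rho(\Phi(\delta_1,\dots,\delta_k))<1$.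
   Context: $\mathcal{X}$ is a non-empty finite set and $\mathcal{L}(\mathcal{X})$ is the vector space of real-valued functions on $\mathcal{X}$; real numbers are identified with constant functions and inequalities between functions are pointwise. $\|f\|:=\max_{x}|f(x)|$, $\|f\|_v:=\max f-\min f$. $\mathbb{I}_x$ is the indicator function of $\{x\}$, and $I$ is the identity operator. The norm of a non-negatively homogeneous operator $A$ on $\mathcal{L}(\mathcal{X})$ (i.e. $A(\mu f)=\mu Af$ for $\mu\ge0$) is $\|A\|:=\sup\{\|Af\|: \|f\|=1\}$. A lower transition rate operator is a map $\underline{Q}:\mathcal{L}(\mathcal{X})\to\mathcal{L}(\mathcal{X})$ such that for all $f,g\in\mathcal{L}(\mathcal{X})$, $\mu\geq 0$, $\gamma\in\mathbb{R}$ and $x\neq y$ in $\mathcal{X}$: $\underline{Q}\gamma=0$; $\underline{Q}(f+g)\geq\underline{Q}f+\underline{Q}g$; $\underline{Q}(\mu f)=\mu\underline{Q}f$; $[\underline{Q}\mathbb{I}_x](y)\geq 0$. For such $\underline{Q}$ and $f\in\mathcal{L}(\mathcal{X})$, $t\mapsto\underline{T}_tf$ denotes the unique solution on $\mathbb{R}_{\ge0}$ of $\frac{\mathrm d}{\mathrm dt}\underline{T}_tf=\underline{Q}\,\underline{T}_tf$ with $\underline{T}_0f=f$ (existence and uniqueness are known). $\underline{Q}$ is ergodic if for all $f\in\mathcal{L}(\mathcal{X})$, $\lim_{t\to\infty}\underline{T}_tf$ exists and is a constant function. For $\delta_i\ge0$ with $\delta_i\|\underline{Q}\|\leq2$, $\Phi(\delta_1,\dots,\delta_k):=(I+\delta_k\underline{Q})\cdots(I+\delta_1\underline{Q})$;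 this is a lower transition operator, i.e. an operator $\underline{T}$ on $\mathcal{L}(\mathcal{X})$ with $\underline{T}f\ge\min f$, $\underline{T}(f+g)\ge\underline{T}f+\underline{T}g$ and $\underline{T}(\mu f)=\mu\underline{T}f$ for all $f,g$ and $\mu\ge0$. The coefficient of ergodicity of a lower transition operator $\underline{T}$ is $\rho(\underline{T}):=\max\{\|\underline{T}f\|_v: f\in\mathcal{L}(\mathcal{X}),\ 0\leq f\leq1\}$. *)

(* Defs.v *)
From HB Require Import structures.
From mathcomp Require Import all_boot all_order all_algebra.
From mathcomp Require Import all_classical all_reals all_analysis.
Set Implicit Arguments.
Unset Strict Implicit.
Unset Printing Implicit Defensive.
Import Order.TTheory GRing.Theory Num.Theory.
Import numFieldNormedType.Exports.
Local Open Scope classical_set_scope.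
Local Open Scope ring_scope.

Section LowerTransitionRateOperators.
Context (R : realType) (X : finType).
Implicit Types (f g : X -> R) (A Q : (X -> R) -> (X -> R)).

(* For X nonempty, [range f] is finite and nonempty, so sup and inf are
   attained. *)
Definition fmax f : R := sup (range f).
Definition fmin f : R := inf (range f).

Definition fnorm f : R := fmax (fun x => `|f x|).
Definition fvar f : R := fmax f - fmin f.

(* [sup] is the real-valued supremum: it has its usual meaning when the set is
   nonempty and bounded above, as is the case when X is nonempty and A is a
   lower transition rate operator. *)
Definition opnorm A : R := sup [set fnorm (A f) | f in [set f | fnorm f = 1]].

Definition lower_transition_rate_operator Q : Prop :=
  [/\ forall c : R, Q (cst c) = cst 0,
      forall f g, forall x, Q f x + Q g x <= Q (f \+ g) x,
      forall (mu : R) f, 0 <= mu -> Q (mu \*o f) = mu \*o Q f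
    & forall x y : X, x != y -> 0 <= Q \1_[set x] y].

(* u solves u' = Q u on [0, +oo[ with u 0 = f. Derivatives are taken in the norm
   [fnorm] and relatively to [0, +oo[: two-sided for t > 0, right derivative at
   t = 0. The values of u at negative times are unconstrained. *)
Definition is_solution Q f (u : R -> X -> R) : Prop :=
  u 0 = f /\
  forall t, 0 <= t ->
    fnorm (fun x => h^-1 * (u (t + h) x - u t x) - Q (u t) x)
      @[h --> within [set h | 0 <= t + h] 0^'] --> (0 : R).

(* The solution is unique on [0, +oo[, so that [lower_semigroup Q t f] does not
   depend on the choice made by [xget] for t >= 0. *)
Definition lower_semigroup Q (t : R) f : X -> R :=
  xget (fun=> f) [set u | is_solution Q f u] t.

Definition ergodic Q : Prop :=
  forall f, exists c : R,
    fnorm (lower_semigroup Q t f \- cst c) @[t --> +oo] --> (0 : R).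

(* Phi Q [:: d_1; ...; d_k] = (I + d_k Q) o ... o (I + d_1 Q): the head of the
   sequence is applied first. *)
Definition Phi Q (d : seq R) f : X -> R :=
  foldl (fun g di => g \+ (di \*o Q g)) f d.

(* A maximum when A is a lower transition operator: A is then continuous and the
   functions with values in [0, 1] form a compact set. *)
Definition ergodicity_coef A : R :=
  sup [set fvar (A f) | f in [set f | forall x, 0 <= f x <= 1]].

End LowerTransitionRateOperators.

(* Main.v *)
(* Write Q f = M (S f - f) with S monotone, positively homogeneous and
   commuting with the addition of constants. This class of generators contains Q
   for M = ||Q|| / 2 (hence the bound 2 on the step sizes) and is closed under
   the duality G |-> - G (- _), which exchanges lower and upper expectations.
   For f >= 0 and a step d with d M < 1, the support A of f becomes
   A u {x | Q 1_A x > 0} under I + d Q, whatever the value of d, and the same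
   holds for 1 - f and the dual of Q. As these sets grow, they are stationary
   after |X| - 1 steps, and everything is governed by the condition [covering]:
   starting from 1_A with A nonempty and proper, the support of f or that of
   1 - f eventually fills X. If it fails for A, two proper subsets remain
   invariant, so that all Phi (1_A) and T_t 1_A take the values 0 and 1. If it
   holds, then rho (Phi) < 1 follows by thresholding functions at 1/2, and a
   quantitative version of the spreading contracts the range of every solution
   at a geometric rate. Solutions are obtained from Euler polygons by an
   ultrafilter limit; conversely Euler polygons approximate any given solution,
   so uniqueness is never needed. *)
Require Import Defs.
From HB Require Import structures.
From mathcomp Require Import all_boot all_order all_algebra.
From mathcomp Require Import all_classical all_reals all_analysis.
From mathcomp Require Import ring lra.
Import Order.TTheory GRing.Theory Num.Theory.
Import numFieldNormedType.Exports.
Local Open Scope ring_scope.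

Lemma finite_pos_lower_bound (R : realType) (I : finType) (P : pred I)
    (F : I -> R) : (forall i, P i -> 0 < F i) ->
  exists2 a, 0 < a & forall i, P i -> a <= F i.
Proof.
(* The default value 1 keeps the minimum positive when no index satisfies [P]. *)
move=> F0; exists (\big[Num.min/1]_(i | P i) F i).
  by elim/big_ind: _ => // a b a0 b0; rewrite lt_min a0.
by move=> i Pi; exact: bigmin_le_cond.
Qed.

(** * Generators, their Euler steps and duality *)

Section Generators.
Set Implicit Arguments.
Unset Strict Implicit.
Context (R : realType) (X : finType).
Implicit Types (f g : X -> R) (G : (X -> R) -> X -> R) (A P : {set X}).
Implicit Types (x y : X) (c d M : R) (s : seq R).

(** For [M > 0] the last condition says that [S f = f + G f / M] is monotone; multiplied through by
    [M] it still makes sense for [M = 0], the case of a rate operator of norm 0. *)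
Definition generator M G : Prop :=
  [/\ forall c f x, 0 <= c -> G (fun y => c * f y) x = c * G f x,
      forall c f x, G (fun y => f y + c) x = G f x
    & forall f g x, (forall y, f y <= g y) ->
        M * f x + G f x <= M * g x + G g x].

Definition dual G f x : R := - G (fun y => - f y) x.

Lemma generator_dual M G : generator M G -> generator M (dual G).
Proof.
case=> [GZ GD Gm]; split=> [c f x c0|c f x|f g x fg]; rewrite /dual.
- rewrite mulrN -GZ //; congr (- G _ x).
  by apply/funext => y; rewrite mulrN.
- rewrite -[in RHS](GD (- c)); congr (- G _ x).
  by apply/funext => y; rewrite opprD.
- have := Gm (fun y => - g y) (fun y => - f y) x.
  by move=> /(_ (fun y => ltac:(rewrite lerN2; exact: fg))); lra.
Qed.

Lemma generatorW M N G : M <= N -> generator M G -> generator N G.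
Proof.
move=> MN [GZ GD Gm]; split=> // f g x fg.
have := Gm f g x fg; have := fg x; nra.
Qed.

Lemma generator_cst M G c x : generator M G -> G (fun=> c) x = 0.
Proof.
case=> [GZ GD _]; rewrite -[RHS](mul0r (G (fun=> 0) x)) -GZ // -[RHS](GD c).
by congr (G _ x); apply/funext => y; rewrite mulr0 add0r.
Qed.

(** Monotonicity of [M I + G] applied to [f <= g + c] gives [G f - G g <= M (g - f + c)], and
    [g - f <= c]. *)
Lemma generator_dist M G f g c x : 0 <= M -> generator M G ->
  (forall y, `|f y - g y| <= c) -> `|G f x - G g x| <= 2 * M * c.
Proof.
move=> M0 [_ GD Gm] fg.
have H f1 g1 : (forall y, `|f1 y - g1 y| <= c) -> G f1 x - G g1 x <= 2 * M * c.
  move=> fg1; have := Gm f1 (fun y => g1 y + c) x; rewrite GD.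
  have le y : f1 y <= g1 y + c by have := fg1 y; rewrite ler_norml; lra.
  move=> /(_ le); have := fg1 x; rewrite ler_norml => /andP[h1 h2]; nra.
rewrite ler_norml (H f g) // andbT.
by have := H g f (fun y => ltac:(rewrite distrC; exact: fg)); lra.
Qed.

Definition euler G d f : X -> R := fun x => f x + d * G f x.

Lemma Phi_cons G d s f : Phi G (d :: s) f = Phi G s (euler G d f).
Proof. by []. Qed.

Lemma Phi_rcons G s d f : Phi G (rcons s d) f = euler G d (Phi G s f).
Proof. by rewrite /Phi foldl_rcons. Qed.

(** The weak bounds make every step monotone; strict ones are imposed separately where strict
    positivity must be preserved. *)
Definition admissible M s : Prop :=
  {in s, forall d, 0 <= d /\ d * M <= 1}.

Lemma admissible_cons M d s :
  admissible M (d :: s) -> [/\ 0 <= d, d * M <= 1 & admissible M s].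
Proof.
move=> H; have [d0 dM] := H d (mem_head _ _); split=> // e es.
by apply: H; rewrite in_cons es orbT.
Qed.

(** [I + d G = (1 - d M) I + d (M I + G)] is a nonnegative combination of monotone maps. *)
Lemma euler_mono M G d f g : generator M G -> 0 <= d -> d * M <= 1 ->
  (forall y, f y <= g y) -> forall y, euler G d f y <= euler G d g y.
Proof.
case=> [_ _ Gm] d0 dM fg y; rewrite /euler.
have h1 : 0 <= (1 - d * M) * (g y - f y) by rewrite mulr_ge0 ?subr_ge0.
have h2 : 0 <= d * (M * g y + G g y - (M * f y + G f y)).
  by rewrite mulr_ge0 // subr_ge0 Gm.
nra.
Qed.

Lemma Phi_mono M G s f g : generator M G -> admissible M s ->
  (forall y, f y <= g y) -> forall y, Phi G s f y <= Phi G s g y.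
Proof.
move=> HG; elim: s f g => [//|d s IH] f g /admissible_cons[d0 dM sM] fg y.
rewrite !Phi_cons; apply: IH => // z; exact: euler_mono HG d0 dM fg z.
Qed.

Lemma PhiD M G s c f : generator M G ->
  Phi G s (fun y => f y + c) = (fun y => Phi G s f y + c).
Proof.
move=> HG; elim: s f => [//|d s IH] f; rewrite !Phi_cons -IH.
congr Phi; apply/funext => y; rewrite /euler.
by case: HG => _ -> _; rewrite addrAC.
Qed.

Lemma PhiZ M G s c f : generator M G -> 0 <= c ->
  Phi G s (fun y => c * f y) = (fun y => c * Phi G s f y).
Proof.
move=> HG c0; elim: s f => [//|d s IH] f; rewrite !Phi_cons -IH.
congr Phi; apply/funext => y; rewrite /euler.
by case: HG => -> // _ _; rewrite mulrDr mulrCA.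
Qed.

Lemma Phi_cst M G s c : generator M G -> Phi G s (fun=> c) = fun=> c.
Proof.
move=> HG; elim: s => [//|d s IH]; rewrite Phi_cons -[RHS]IH.
congr Phi; apply/funext => y; rewrite /euler.
by rewrite (generator_cst c y HG) mulr0 addr0.
Qed.

Lemma Phi_dual G s f :
  Phi (dual G) s f = fun x => - Phi G s (fun y => - f y) x.
Proof.
elim: s f => [|d s IH] f.
  by apply/funext => y; rewrite /Phi /= opprK.
rewrite !Phi_cons IH; apply/funext => x; congr (- Phi _ _ _ _).
by apply/funext => y; rewrite /euler /dual mulrN opprD opprK.
Qed.

Lemma Phi_dual_compl M G s f : generator M G ->
  Phi (dual G) s (fun x => 1 - f x) = fun x => 1 - Phi G s f x.
Proof.
move=> HG; rewrite Phi_dual; apply/funext => x.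
have -> : (fun y => - (1 - f y)) = (fun y => f y + -1).
  by apply/funext => y; rewrite opprB.
by rewrite (PhiD _ _ _ HG) opprD opprK addrC.
Qed.

Lemma Phi_range M G s f a b : generator M G -> admissible M s ->
  (forall y, a <= f y <= b) -> forall y, a <= Phi G s f y <= b.
Proof.
move=> HG sM fab y; apply/andP; split.
  have <- := congr1 (fun h => h y) (Phi_cst s a HG).
  by apply: (Phi_mono HG sM) => z; case/andP: (fab z).
have <- := congr1 (fun h => h y) (Phi_cst s b HG).
by apply: (Phi_mono HG sM) => z; case/andP: (fab z).
Qed.

(** A monotone map that commutes with the addition of constants is nonexpansive in the sup norm. *)
Lemma Phi_dist M G s f g c : generator M G -> admissible M s ->
  (forall y, `|f y - g y| <= c) -> forall y, `|Phi G s f y - Phi G s g y| <= c.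
Proof.
move=> HG sM.
have H f1 g1 : (forall y, `|f1 y - g1 y| <= c) ->
    forall y, Phi G s f1 y - Phi G s g1 y <= c.
  move=> fg y; rewrite lerBlDl.
  rewrite -[leRHS]/((fun y => Phi G s g1 y + c) y) -(PhiD s c g1 HG).
  by apply: (Phi_mono HG sM) => z; have := fg z; rewrite ler_norml; lra.
move=> fg y; rewrite ler_norml H // andbT.
by have := H g f (fun y => ltac:(rewrite distrC; exact: fg)) y; lra.
Qed.

(** * Spread of supports under Euler steps *)

Definition ind A : X -> R := fun x => (x \in A)%:R.

Lemma ind01 A x : 0 <= ind A x <= 1.
Proof. by rewrite /ind; case: (x \in A); rewrite /= lexx ler01. Qed.

Lemma indC A : ind (~: A) = fun x => 1 - ind A x.
Proof.
apply/funext => x; rewrite /ind finset.in_setC.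
by case: (x \in A); rewrite /= ?subrr ?subr0.
Qed.

Definition reach G A : {set X} := [set x | (x \in A) || (0 < G (ind A) x)].

Lemma sub_reach G A : A \subset reach G A.
Proof. by apply/fintype.subsetP => x xA; rewrite finset.in_set xA. Qed.

Lemma generator_ge_ind M G A f a x : generator M G -> 0 <= a ->
  (forall y, 0 <= f y) -> (forall y, y \in A -> a <= f y) ->
  a * (M * ind A x + G (ind A) x) <= M * f x + G f x.
Proof.
case=> GZ _ Gm a0 f0 fA; rewrite mulrDr -GZ // mulrCA.
apply: Gm => y; rewrite /ind; case: (boolP (y \in A)) => [/fA|_].
  by rewrite mulr1.
by rewrite mulr0.
Qed.

(** In [(1 - d M) f + d (M f + G f)] the first term is positive on [A]. Off [A], the second is at
    least [d a G 1_A], where [a] is a positive lower bound of [f] on [A]. *)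
Lemma euler_pos M G d A f : generator M G -> 0 < d -> d * M < 1 ->
  (forall y, 0 <= f y) -> (forall y, y \in A -> 0 < f y) ->
  (forall y, 0 <= euler G d f y) /\
  (forall y, y \in reach G A -> 0 < euler G d f y).
Proof.
move=> HG d0 dM f0 fA.
have f_ge0 y : 0 <= M * f y + G f y.
  have [_ _ /(_ (fun=> 0) f y f0)] := HG.
  by rewrite (generator_cst _ _ HG) mulr0 addr0.
have E y : euler G d f y = (1 - d * M) * f y + d * (M * f y + G f y).
  by rewrite /euler; ring.
split=> y.
  by rewrite E addr_ge0 // mulr_ge0 // ?ltW // subr_gt0.
rewrite finset.in_set; case: (boolP (y \in A)) => [/fA fy _|yA /= Gy].
  by rewrite E ltr_pwDl // ?mulr_gt0 ?subr_gt0 // mulr_ge0 // ltW.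
have [a a0 fa] := @finite_pos_lower_bound R X (mem A) f fA.
have := generator_ge_ind y HG (ltW a0) f0 fa.
rewrite {1}/ind (negbTE yA) mulr0 add0r E => H.
apply: ltr_wpDl; first by rewrite mulr_ge0 // ltW // subr_gt0.
by rewrite mulr_gt0 // (lt_le_trans _ H) // mulr_gt0.
Qed.

Lemma Phi_pos M G s A f : generator M G ->
  {in s, forall d, 0 < d /\ d * M < 1} ->
  (forall y, 0 <= f y) -> (forall y, y \in A -> 0 < f y) ->
  forall y, y \in iter (size s) (reach G) A -> 0 < Phi G s f y.
Proof.
move=> HG; elim: s A f => [|d s IH] A f sM f0 fA; first exact: fA.
have [d0 dM] := sM d (mem_head _ _).
have [g0 gA] := euler_pos HG d0 dM f0 fA.
rewrite Phi_cons [size _]/= iterSr; apply: IH gA => // e es.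
by apply: sM; rewrite in_cons es orbT.
Qed.

(** A stationary set traps the support: inside [A] the comparison is with the constant 1, and
    outside [A] stationarity means [G 1_A <= 0]. *)
Lemma Phi_closed M G s A f : generator M G -> admissible M s ->
  reach G A = A -> (forall y, f y <= ind A y) ->
  forall y, Phi G s f y <= ind A y.
Proof.
move=> HG + Acl; elim: s f => [//|d s IH] f /admissible_cons[d0 dM sM] fA.
rewrite Phi_cons; apply: IH => // y.
apply: le_trans (euler_mono HG d0 dM fA y) _.
case: (boolP (y \in A)) => yA.
  apply: le_trans (euler_mono (g := fun=> 1) HG d0 dM _ y) _.
    by move=> z; case/andP: (ind01 A z).
  by rewrite /euler (generator_cst _ _ HG) mulr0 addr0 /ind yA.
have : y \notin reach G A by rewrite Acl.
rewrite finset.in_set (negbTE yA) /= -leNgt => Gy.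
by rewrite /euler /ind (negbTE yA) add0r mulr_ge0_le0.
Qed.

(** The chain starts with at least one point and gains one at each step until it is stationary, so
    still growing after [#|X|.-1] steps it would have filled [X]. *)
Lemma iter_reach_closed G A : A != finset.set0 ->
  let P := iter #|X|.-1 (reach G) A in P != finset.setT -> reach G P = P.
Proof.
move=> A0 P PT; have H j : let P := iter j (reach G) A in
    reach G P = P \/ (j < #|P|)%N.
  elim: j => [|j [IH|IH]] /=; first by right; rewrite card_gt0.
    by left; rewrite !IH.
  have [E|NE] := eqVneq (reach G (iter j (reach G) A)) (iter j (reach G) A).
    by left; rewrite !E.
  right; apply: leq_ltn_trans IH _; apply: proper_card.
  by rewrite finset.properEneq eq_sym NE sub_reach.
case: (H #|X|.-1) => // lt; case/eqP: PT; apply/eqP.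
by rewrite finset.eqEcard finset.subsetT cardsT (leq_trans (leqSpred _) lt).
Qed.

Lemma iter_reach_subset G A m n : (m <= n)%N ->
  iter m (reach G) A \subset iter n (reach G) A.
Proof.
move=> /subnK <-; elim: (n - m)%N => [//|k IH].
by rewrite addSn /=; apply: fintype.subset_trans IH (sub_reach _ _).
Qed.

Definition covering G : Prop := forall A, A != finset.set0 -> A != finset.setT ->
  iter #|X|.-1 (reach G) A = finset.setT \/
  iter #|X|.-1 (reach (dual G)) (~: A) = finset.setT.

End Generators.

(** * Solutions of the differential equation and their approximation by Euler steps *)

Section Solutions.
Set Implicit Arguments.
Unset Strict Implicit.
Context (R : realType) (X : finType).
Implicit Types (f g : X -> R) (G : (X -> R) -> X -> R) (u : R -> X -> R).
Implicit Types (x y : X) (c d e h t M : R) (s : seq R).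

Lemma finite_bounded f : exists2 K, 0 <= K & forall x, `|f x| <= K.
Proof.
exists (\sum_x `|f x|); first exact: sumr_ge0.
by move=> x; rewrite (bigD1 x) //= lerDl sumr_ge0.
Qed.

Lemma fnorm_ge f x : `|f x| <= fnorm f.
Proof.
have [K _ fK] := finite_bounded f.
apply: ub_le_sup; last by exists x.
by exists K => _ [y _ <-].
Qed.

Lemma fnorm_le f c : (0 < #|X|)%N -> (forall x, `|f x| <= c) -> fnorm f <= c.
Proof.
move=> /card_gt0P[x0 _] fc; apply: ge_sup; first by exists `|f x0|, x0.
by move=> _ [y _ <-].
Qed.

(** The derivative in epsilon form, pointwise and multiplied by [h]: no division occurs and [h = 0]
    is harmless. *)
Definition solves G f u : Prop := u 0 = f /\
  forall t e, 0 <= t -> 0 < e -> exists2 r : R, 0 < r &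
    forall h, `|h| < r -> 0 <= t + h ->
    forall x, `|u (t + h) x - u t x - h * G (u t) x| <= e * `|h|.

Lemma is_solutionP G f u : (0 < #|X|)%N ->
  is_solution G f u <-> solves G f u.
Proof.
move=> X0; split=> -[u0 du]; split=> // t.
  move=> e t0 e0; have /cvgrPdist_le /(_ e e0) := du t t0.
  rewrite near_withinE => -[r /= r0 H]; exists r => // h hr th x.
  have [->|h0] := eqVneq h 0.
    by rewrite addr0 subrr mul0r subrr normr0 mulr0.
  have := H h; rewrite /= sub0r normrN => /(_ hr h0 th).
  rewrite sub0r normrN => /(le_trans (ler_norm _)) /(le_trans (fnorm_ge _ x)).
  have -> : h^-1 * (u (t + h) x - u t x) - G (u t) x =
            h^-1 * (u (t + h) x - u t x - h * G (u t) x).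
    by rewrite [RHS]mulrBr mulKf.
  by rewrite normrM normfV ler_pdivrMl ?normr_gt0 // [`|h| * e]mulrC.
move=> t0; apply/cvgrPdist_le => e e0.
have [r r0 H] := du t e t0 e0.
rewrite near_withinE; exists r => //= h.
rewrite /ball_ /= sub0r normrN => hr h0 th.
rewrite sub0r normrN ger0_norm; last first.
  by have [x0 _] := card_gt0P X0; exact: le_trans (fnorm_ge _ x0).
apply: fnorm_le => // x.
have -> : h^-1 * (u (t + h) x - u t x) - G (u t) x =
          h^-1 * (u (t + h) x - u t x - h * G (u t) x).
  by rewrite [RHS]mulrBr mulKf.
by rewrite normrM normfV ler_pdivrMl ?normr_gt0 // [`|h| * e]mulrC H.
Qed.

Lemma solves_shift G f u t0 : 0 <= t0 -> solves G f u ->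
  solves G (u t0) (fun t => u (t0 + t)).
Proof.
move=> t00 [_ du]; split; first by rewrite addr0.
move=> t e t_ge0 e0; have [r r0 H] := du (t0 + t) e (addr_ge0 t00 t_ge0) e0.
exists r => // h hr th x; rewrite addrA; apply: H => //.
by rewrite -addrA addr_ge0.
Qed.

Lemma solvesD M G f u c : generator M G -> solves G f u ->
  solves G (fun x => f x + c) (fun t x => u t x + c).
Proof.
case=> _ GD _ [<- du]; split=> // t e t0 e0; have [r r0 H] := du t e t0 e0.
exists r => // h hr th x; rewrite GD.
by rewrite opprD addrACA subrr addr0 H.
Qed.

Lemma solves_dual G f u : solves G f u ->
  solves (dual G) (fun x => - f x) (fun t x => - u t x).
Proof.
case=> [<- du]; split=> // t e t0 e0; have [r r0 H] := du t e t0 e0.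
exists r => // h hr th x; rewrite /dual.
have -> : (fun y => - - u t y) = u t by apply/funext => y; rewrite opprK.
by rewrite mulrN -!opprD normrN H.
Qed.

Lemma solves_compl M G f u c : generator M G -> solves G f u ->
  solves (dual G) (fun x => c - f x) (fun t x => c - u t x).
Proof.
move=> HG /solves_dual /(solvesD c (generator_dual HG)).
have E : (fun t x => - u t x + c) = (fun t x => c - u t x).
  by apply/funext => t; apply/funext => x; rewrite addrC.
by rewrite E; under eq_fun do rewrite addrC.
Qed.

(** The forward estimate is differentiability at [t]. The backward one evaluates [G] at [u (t - h)]
    instead of [u t], a change controlled by the Lipschitz bound on [G]. *)
Lemma solves_euler M G f u t e : generator M G -> 0 <= M -> solves G f u ->
  0 <= t -> 0 < e -> exists2 r : R, 0 < r &
  forall h, 0 <= h -> h < r -> [/\ h * M <= 1,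
    forall x, `|u (t + h) x - euler G h (u t) x| <= e * h &
    h <= t -> forall x, `|u t x - euler G h (u (t - h)) x| <= e * h].
Proof.
move=> HG M0 [_ du] t0 e0.
have [r1 r10 H1] := du t (e / 2) t0 ltac:(lra).
have [K K0 HK] := finite_bounded (G (u t)).
(* [h * C] will bound the change of [G] between [u t] and [u (t - h)]. *)
pose C := 2 * M * (e / 2 + K).
have C0 : 0 <= C by rewrite /C !mulr_ge0 ?addr_ge0 // ltW // divr_gt0.
pose r := Num.min r1 (Num.min (M + 1)^-1 (e / 2 / (C + 1))).
exists r.
  by rewrite /r !lt_min r10 invr_gt0 !divr_gt0 //; lra.
move=> h h0; rewrite /r !lt_min => /and3P[hr1 hM hC].
have hM1 : h * (M + 1) < 1 by rewrite -ltr_pdivlMr ?div1r //; lra.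
have hC1 : h * (C + 1) < e / 2 by rewrite -ltr_pdivlMr //; lra.
have nh : `|h| = h by rewrite ger0_norm.
split=> [|x|ht x]; first by nra.
  have := H1 h; rewrite nh => /(_ hr1 (addr_ge0 t0 h0) x).
  rewrite /euler opprD addrA => H; apply: le_trans H _.
  by rewrite ler_wpM2r //; lra.
have H := H1 (- h); rewrite normrN nh subr_ge0 in H.
have {}H := H hr1 ht.
have D y : `|u (t - h) y - u t y| <= h * (e / 2 + K).
  have := H y; have := HK y; rewrite !ler_norml => /andP[a1 a2] /andP[b1 b2].
  by apply/andP; split; nra.
have := generator_dist x M0 HG D.
have -> : 2 * M * (h * (e / 2 + K)) = h * C by rewrite /C; ring.
have := H x; rewrite /euler !ler_norml => /andP[a1 a2] /andP[b1 b2].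
have hC2 : h * C <= e / 2 by nra.
have p1 : 0 <= h * (e / 2 - (G (u (t - h)) x - G (u t) x)).
  by rewrite mulr_ge0 //; lra.
have p2 : 0 <= h * (e / 2 + (G (u (t - h)) x - G (u t) x)).
  by rewrite mulr_ge0 //; lra.
by apply/andP; split; lra.
Qed.

(* Euler polygons with suitable steps follow any solution: the admissible times
   are closed under limits from the left and can be extended to the right. *)
Lemma solves_approx M G f u T e : generator M G -> 0 <= M -> solves G f u ->
  0 <= T -> 0 < e -> exists s, [/\ admissible M s, \sum_(d <- s) d = T &
    forall x, `|u T x - Phi G s f x| <= e * T].
Proof.
move=> HG M0 Hu T0 e0.
pose good t := exists s, [/\ admissible M s, \sum_(d <- s) d = t &
  forall x, `|u t x - Phi G s f x| <= e * t].
(* Euler steps are nonexpansive, so appending one only adds its local error, and the total error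
   stays proportional to time. *)
have step t t' : good t -> t <= t' -> (t' - t) * M <= 1 ->
    (forall x, `|u t' x - euler G (t' - t) (u t) x| <= e * (t' - t)) -> good t'.
  move=> [s [sM st su]] tt' hM H; exists (rcons s (t' - t)); split.
  - move=> d; rewrite mem_rcons in_cons => /orP[/eqP ->|/sM //].
    by rewrite subr_ge0.
  - by rewrite -cats1 big_cat big_seq1 /= st addrC subrK.
  - move=> x; rewrite Phi_rcons.
    have sM1 : admissible M [:: t' - t].
      by move=> d; rewrite mem_seq1 => /eqP ->; rewrite subr_ge0.
    have := Phi_dist HG sM1 su x; rewrite !Phi_cons /= => E.
    have -> : e * t' = e * (t' - t) + e * t by ring.
    rewrite -(subrKA (euler G (t' - t) (u t) x)).
    by apply: le_trans (ler_normD _ _) _; rewrite lerD.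
pose E := [set t | [/\ 0 <= t, t <= T & good t]]%classic.
have E0 : E 0.
  split=> //; exists [::]; split=> //; first by rewrite big_nil.
  by move=> x; case: Hu => -> _; rewrite /Phi /= subrr normr0 mulr0.
have supE : has_sup E by split; [exists 0|exists T => t []].
pose t0 := sup E.
have t0_ge0 : 0 <= t0 by exact: sup_upper_bound.
have t0_le : t0 <= T by apply: ge_sup; [exists 0|move=> t []].
have [r r0 H] := solves_euler HG M0 Hu t0_ge0 e0.
have good0 : good t0.
  have [t [t_ge0 tT gt] tr] := sup_adherent r0 supE.
  have tt0 : t <= t0 by apply: sup_upper_bound.
  have [||hM _ bw] := H (t0 - t); [lra|rewrite /t0; lra|].
  apply: (step t) => // x.
  have := bw ltac:(lra) x; by have -> : t0 - (t0 - t) = t by ring.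
have [tT|Tt0] := ltP t0 T; last first.
  by have <- : t0 = T by apply/eqP; rewrite eq_le t0_le.
pose h := Num.min (r / 2) (T - t0).
have h0 : 0 < h by rewrite /h lt_min subr_gt0 tT divr_gt0.
have hr : h < r by rewrite /h gt_min; apply/orP; left; lra.
have hT : h <= T - t0 by rewrite /h ge_min lexx orbT.
have [hM fw _] := H h (ltW h0) hr.
suff : E (t0 + h) by move=> /(sup_upper_bound supE); rewrite -/t0; lra.
split; [lra|lra|apply: (step t0) => //].
- lra.
- by have -> : t0 + h - t0 = h by ring.
- by have -> : t0 + h - t0 = h by ring.
Qed.

Lemma solves_ge M G f u t x a : generator M G -> 0 <= M -> solves G f u ->
  0 <= t -> (forall s, admissible M s -> \sum_(d <- s) d = t ->
    a <= Phi G s f x) -> a <= u t x.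
Proof.
move=> HG M0 Hu t0 H; apply/ler_addgt0Pr => e e0.
(* The accumulated error is this value times [t], hence at most [e]; adding 1 covers [t = 0]. *)
have e1 : 0 < e / (t + 1) by rewrite divr_gt0 //; lra.
have [s [sM st su]] := solves_approx HG M0 Hu t0 e1.
have := su x; have := H s sM st; rewrite ler_norml => Hs /andP[Hl _].
have : e / (t + 1) * t <= e.
  by rewrite mulrAC ler_pdivrMr ?ler_pM2l //; lra.
lra.
Qed.

Lemma solves_le M G f u t x a : generator M G -> 0 <= M -> solves G f u ->
  0 <= t -> (forall s, admissible M s -> \sum_(d <- s) d = t ->
    Phi G s f x <= a) -> u t x <= a.
Proof.
move=> HG M0 Hu t0 H.
rewrite -lerN2; apply: (solves_ge (generator_dual HG) M0 (solves_dual Hu) t0).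
move=> s sM st; rewrite Phi_dual lerN2.
have -> : (fun y => - - f y) = f by apply/funext => y; rewrite opprK.
exact: H.
Qed.

Lemma solves_range M G f u t a b : generator M G -> 0 <= M -> solves G f u ->
  0 <= t -> (forall y, a <= f y <= b) -> forall x, a <= u t x <= b.
Proof.
move=> HG M0 Hu t0 fab x; apply/andP; split.
  apply: (solves_ge HG M0 Hu t0) => s sM _.
  by have /andP[] := Phi_range HG sM fab x.
apply: (solves_le HG M0 Hu t0) => s sM _.
by have /andP[] := Phi_range HG sM fab x.
Qed.

End Solutions.

(** * Existence of solutions *)

Section Existence.
Set Implicit Arguments.
Unset Strict Implicit.
Context (R : realType) (X : finType).
Implicit Types (f g : X -> R) (G : (X -> R) -> X -> R) (u : R -> X -> R).
Implicit Types (x y : X) (h t M B : R).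

(** Compactness of [[-B, B]] gives a cluster point. An ultrafilter contains each closeness set or
    its complement, and clustering excludes the complement. *)
Lemma bounded_ultra_cvg (T : Type) (F : set_system T) (v : T -> R) B :
  UltraFilter F -> (forall n, `|v n| <= B) ->
  exists l : R, forall e : R, 0 < e -> \forall n \near F, `|l - v n| <= e.
Proof.
move=> UF vB; have FF : ProperFilter F by exact: ultra_proper.
have [] := @segment_compact R (- B) B (v @ F)%classic _.
  rewrite /fmap; apply: (@filterS _ F _ setT); last exact: filterT.
  by move=> n _; rewrite /= in_itv /= -ler_norml.
move=> l [_ vl]; exists l => e e0.
have [//|FA] := in_ultra_setVsetC [set n | `|l - v n| <= e]%classic UF.
have [] := vl (~` [set r | `|l - r| <= e])%classic (ball (l : R) e).
- exact: FA.
- exact: nbhsx_ballx.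
- by move=> r [/= nr /ltW].
Qed.

Lemma Phi_nseqS G h g n :
  Phi G (nseq n.+1 h) g = euler G h (Phi G (nseq n h) g).
Proof. by rewrite -Phi_rcons -cats1 -[[:: h]]/(nseq 1 h) -nseqD addn1. Qed.

Lemma Phi_nseqD G h g m n :
  Phi G (nseq (m + n) h) g = Phi G (nseq n h) (Phi G (nseq m h) g).
Proof. by rewrite nseqD /Phi foldl_cat. Qed.

Lemma admissible_nseq M h n : 0 <= h -> h * M <= 1 -> admissible M (nseq n h).
Proof. by move=> h0 hM d /nseqP[->]. Qed.

Lemma Phi_bounded M G s g B : generator M G -> admissible M s ->
  (forall y, `|g y| <= B) -> forall y, `|Phi G s g y| <= B.
Proof.
move=> HG sM gB y; rewrite ler_norml; apply: (Phi_range HG sM) => z.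
by rewrite -ler_norml.
Qed.

Lemma generator_bounded M G g B y : 0 <= M -> generator M G ->
  (forall y, `|g y| <= B) -> `|G g y| <= 2 * M * B.
Proof.
move=> M0 HG gB; rewrite -[G g y]subr0 -(generator_cst 0 y HG).
by apply: (generator_dist (g := fun=> 0) y M0 HG) => z; rewrite subr0.
Qed.

Section Polygon.
Context (G : (X -> R) -> X -> R) (M h B : R).
Hypotheses (HG : generator M G) (M0 : 0 <= M) (B0 : 0 <= B).
Hypotheses (h0 : 0 <= h) (hM : h * M <= 1).
Let K : R := 2 * M * B.

Lemma Phi_nseq_sub n g : (forall y, `|g y| <= B) ->
  forall y, `|Phi G (nseq n h) g y - g y| <= n%:R * h * K.
Proof.
move=> gB; elim: n => [|n IH] y.
  by rewrite /Phi /= subrr normr0 !mul0r.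
have := IH y; have nM := admissible_nseq (n := n) h0 hM.
have := generator_bounded y M0 HG (Phi_bounded HG nM gB).
rewrite Phi_nseqS /euler -/K -[n.+1%:R]natr1 !ler_norml => /andP[a1 a2] /andP[b1 b2].
have := ler_wpM2l h0 a1; have := ler_wpM2l h0 a2.
by move=> c1 c2; apply/andP; split; lra.
Qed.

(** After [a] steps the function has moved by at most [a h K], so the next step departs from [h G g]
    by at most [2 M K a h^2]; these departures sum to a multiple of [(n h)^2]. *)
Lemma Phi_nseq_linear n g : (forall y, `|g y| <= B) ->
  forall y, `|Phi G (nseq n h) g y - g y - n%:R * h * G g y| <=
    2 * M * K * (n%:R * h) ^+ 2.
Proof.
move=> gB; elim: n => [|n IH] y.
  by rewrite /Phi /= !mul0r subrr subr0 normr0 expr0n mulr0.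
have := IH y; have := generator_dist y M0 HG (Phi_nseq_sub n gB).
rewrite Phi_nseqS /euler -[n.+1%:R]natr1.
set p := Phi _ _ _ in IH *; set a := n%:R => H1 H2.
have K0 : 0 <= K by rewrite /K !mulr_ge0.
have a0 : 0 <= a by [].
have -> : p y + h * G p y - g y - (a + 1) * h * G g y =
  (p y - g y - a * h * G g y) + h * (G p y - G g y) by ring.
apply: le_trans (ler_normD _ _) _; rewrite normrM (ger0_norm h0).
have H3 : h * `|G p y - G g y| <= h * (2 * M * (a * h * K)) by rewrite ler_wpM2l.
have : 0 <= 2 * M * K * h ^+ 2 * (a + 1).
  have a1 : 0 <= a + 1 by lra.
  by rewrite !mulr_ge0.
nra.
Qed.

(** Piecewise constant: the incomplete last step is dropped, an error of at most [h] in the elapsed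
    time for [t >= 0]. *)
Definition polygon f t : X -> R := Phi G (nseq (Num.trunc (t / h)) h) f.

(** The number [j] of grid steps between the two times satisfies [|j h - (t' - t)| <= h]; replacing
    [j h] by [t' - t] costs the term [h K]. *)
Lemma polygon_forward f t t' x : 0 < h -> (forall y, `|f y| <= B) ->
  0 <= t -> t <= t' ->
  `|polygon f t' x - polygon f t x - (t' - t) * G (polygon f t) x| <=
    2 * M * K * (t' - t + h) ^+ 2 + h * K /\
  `|polygon f t' x - polygon f t x| <= (t' - t + h) * K.
Proof.
move=> h1 fB t0 tt'; rewrite /polygon.
have t1 : 0 <= t / h by rewrite divr_ge0.
have t1' : 0 <= t' / h by rewrite divr_ge0 //; lra.
have := truncn_itv t1; have := truncn_itv t1'.
have : (Num.trunc (t / h) <= Num.trunc (t' / h))%N.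
  by rewrite le_truncn // ler_pM2r ?invr_gt0.
move=> /subnK; set i := Num.trunc (t / h); set j := (_ - i)%N => <-.
rewrite addnC Phi_nseqD -[i.+1%:R]natr1 -[(i + j).+1%:R]natr1 natrD.
rewrite !ler_pdivlMr // !ltr_pdivrMr // => /andP[a1 a2] /andP[b1 b2].
set g := Phi G (nseq i h) f.
have iM := admissible_nseq (n := i) h0 hM.
have gB : forall y, `|g y| <= B by apply: (Phi_bounded HG iM fB).
have H1 := Phi_nseq_sub j gB x; have H2 := Phi_nseq_linear j gB x.
have H3 := generator_bounded x M0 HG gB; rewrite -/K in H3.
have K0 : 0 <= K by rewrite /K !mulr_ge0.
have j0 : 0 <= j%:R :> R by [].
have j1 : j%:R * h <= t' - t + h by nra.
have j2 : `|j%:R * h - (t' - t)| <= h by rewrite ler_norml; apply/andP; split; nra.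
split; last by apply: le_trans H1 _; rewrite ler_wpM2r.
set p := Phi G (nseq j h) g.
have -> : p x - g x - (t' - t) * G g x =
  (p x - g x - j%:R * h * G g x) + (j%:R * h - (t' - t)) * G g x by ring.
apply: le_trans (ler_normD _ _) _; apply: lerD; last first.
  by rewrite normrM ler_pM.
apply: le_trans H2 _; apply: ler_wpM2l; first by rewrite !mulr_ge0.
by rewrite ler_sqr ?nnegrE ?mulr_ge0 //; lra.
Qed.

(** For [t' < t] the times are exchanged and [G] is moved from one base point to the other; its
    Lipschitz bound accounts for the doubled constant. *)
Lemma polygon_linear f t t' x : 0 < h -> (forall y, `|f y| <= B) ->
  0 <= t -> 0 <= t' ->
  `|polygon f t' x - polygon f t x - (t' - t) * G (polygon f t) x| <=
    4 * M * K * (`|t' - t| + h) ^+ 2 + h * K.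
Proof.
move=> h1 fB t0 t0'.
have K0 : 0 <= K by rewrite /K !mulr_ge0.
have MK : 0 <= 2 * M * K by rewrite !mulr_ge0.
have [tt'|/ltW tt'] := leP t t'.
  have [H _] := polygon_forward x h1 fB t0 tt'.
  rewrite [`|t' - t|]ger0_norm ?subr_ge0 //.
  apply: le_trans H _; rewrite lerD2r.
  have := mulr_ge0 MK (sqr_ge0 (t' - t + h)); lra.
have [H _] := polygon_forward x h1 fB t0' tt'.
have D y : `|polygon f t' y - polygon f t y| <= (t - t' + h) * K.
  by rewrite distrC; have [_] := polygon_forward y h1 fB t0' tt'.
have := generator_dist x M0 HG D.
rewrite [`|t' - t|]ler0_norm ?subr_le0 // opprB.
set v := polygon f t; set v' := polygon f t' in H D * => H3.
have -> : v' x - v x - (t' - t) * G v x =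
  - (v x - v' x - (t - t') * G v' x) - (t - t') * (G v' x - G v x) by ring.
apply: le_trans (ler_normB _ _) _.
rewrite normrN normrM [`|t - t'|]ger0_norm ?subr_ge0 //.
have H4 : (t - t') * `|G v' x - G v x| <= (t - t') * (2 * M * ((t - t' + h) * K)).
  by rewrite ler_wpM2l // subr_ge0.
have : 0 <= 2 * M * K * ((t - t' + h) * h).
  by rewrite !mulr_ge0 // addr_ge0 // subr_ge0.
nra.
Qed.

End Polygon.

Lemma solves_exists M G f : generator M G -> 0 <= M -> exists u, solves G f u.
Proof.
move=> HG M0.
(* Along one ultrafilter the polygons converge at all times and points at once, without extracting
   subsequences. *)
have [U [UU oU]] := ultraFilterLemma (F := \oo%classic) _.
have FU : ProperFilter U by exact: ultra_proper.
have [B B0 fB] := finite_bounded f.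
(* Using [M + 1] gives [h m * M <= 1] for every [m] and avoids division by zero when [M = 0]. *)
pose h (m : nat) : R := ((M + 1) * m.+1%:R)^-1.
have h0 m : 0 < h m by rewrite invr_gt0 mulr_gt0 // ltr_wpDl.
have hM m : h m * M <= 1.
  rewrite mulrC ler_pdivrMr ?mul1r; last by rewrite mulr_gt0 // ltr_wpDl.
  have : (1 : R) <= m.+1%:R by rewrite ler1n.
  by nra.
have h_to0 e : 0 < e -> \forall m \near U, h m <= e.
  move=> e0; apply: oU; exists (Num.bound e^-1) => // m /= bm.
  rewrite /h invf_ple ?posrE ?mulr_gt0 ?ltr_wpDl //.
  have : e^-1 < (Num.bound e^-1)%:R by rewrite archi_boundP // invr_ge0 ltW.
  have : ((Num.bound e^-1)%:R : R) <= m.+1%:R by rewrite ler_nat; exact: leqW.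
  have : 0 < m.+1%:R :> R by [].
  by nra.
pose p m := polygon G (h m) f.
have pB m t x : `|p m t x| <= B.
  have sM := admissible_nseq (n := (Num.trunc (t / h m))) (ltW (h0 m)) (hM m).
  exact: (Phi_bounded HG sM fB).
have lim_ex t x : exists l : R,
    forall e : R, 0 < e -> \forall m \near U, `|l - p m t x| <= e.
  by apply: (bounded_ultra_cvg UU) => m; exact: pB.
pose u t x : R := projT1 (cid (lim_ex t x)).
have uP t e : 0 < e -> \forall m \near U, forall x, `|u t x - p m t x| <= e.
  move=> e0; apply: filter_forall => x.
  by rewrite /u; case: cid => l /= /(_ e e0).
exists u; split.
  apply/funext => x; apply/eqP; rewrite -subr_eq0 -normr_le0.
  apply/ler_addgt0Pr => e e0; rewrite add0r.
  have [m /(_ x)] := filter_ex (uP 0 e e0).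
  by rewrite /p /polygon mul0r truncn0.
pose K := 2 * M * B; have K0 : 0 <= K by rewrite /K !mulr_ge0.
have MK : 0 <= M * K by rewrite mulr_ge0.
(* In the limit the terms in [h] vanish and a bound quadratic in [t' - t] remains, which yields the
   derivative. *)
have est t t' x : 0 <= t -> 0 <= t' ->
    `|u t' x - u t x - (t' - t) * G (u t) x| <= 4 * M * K * `|t' - t| ^+ 2.
  move=> t0 t0'; set r := `|t' - t|; have r0 : 0 <= r by exact: normr_ge0.
  apply/ler_addgt0Pr => e e0.
  (* [C] collects the coefficients of [d] in the error: two pointwise approximations, the Lipschitz
     term, the expansion of [(r + h m)^2] (where [d <= 1] is used), and [h m * K]. *)
  pose C := 2 + 2 * M * r + 4 * M * K * (2 * r + 1) + K.
  have C0 : 0 < C + 1.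
    by rewrite ltr_wpDl // /C !addr_ge0 // !mulr_ge0 // addr_ge0 // mulr_ge0.
  pose d := Num.min 1 (e / (C + 1)).
  have d0 : 0 < d by rewrite /d lt_min ltr01 divr_gt0.
  have d1 : d <= 1 by rewrite /d ge_min lexx.
  have dC : d * C <= e.
    have : d <= e / (C + 1) by rewrite /d ge_min lexx orbT.
    by rewrite ler_pdivlMr //; lra.
  have [m [[/(_ x) H1 H2] hd]] :=
    filter_ex (filterI (filterI (uP t' d d0) (uP t d d0)) (h_to0 d d0)).
  have H3 := polygon_linear HG M0 B0 (ltW (h0 m)) (hM m) x (h0 m) fB t0 t0'.
  have H4 := generator_dist x M0 HG H2.
  rewrite -/K -/r -/(p m) in H3.
  have -> : u t' x - u t x - (t' - t) * G (u t) x =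
    (u t' x - p m t' x) + (p m t' x - p m t x - (t' - t) * G (p m t) x)
    - (u t x - p m t x) - (t' - t) * (G (u t) x - G (p m t) x) by ring.
  have H5 : `|(t' - t) * (G (u t) x - G (p m t) x)| <= r * (2 * M * d).
    by rewrite normrM ler_wpM2l.
  apply: le_trans (ler_normB _ _) _; apply: le_trans (lerD (ler_normB _ _) H5) _.
  have H6 : (r + h m) ^+ 2 <= r ^+ 2 + d * (2 * r + 1).
    have := h0 m; nra.
  have H7 : 4 * M * K * (r + h m) ^+ 2 + h m * K <=
      4 * M * K * (r ^+ 2 + d * (2 * r + 1)) + d * K.
    apply: lerD; last by rewrite ler_wpM2r.
    by rewrite ler_wpM2l // -mulrA mulr_ge0.
  have := ler_normD (u t' x - p m t' x)
     (p m t' x - p m t x - (t' - t) * G (p m t) x).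
  have := H2 x; rewrite /C in dC; lra.
move=> t e t0 e0; exists (e / (4 * M * K + 1)).
  by rewrite divr_gt0 // ltr_wpDl // -mulrA mulr_ge0.
move=> d dr td x; have := est t (t + d) x t0 td.
have -> : t + d - t = d by ring.
move=> /le_trans; apply; rewrite expr2 mulrA ler_wpM2r //.
have MK4 : 0 <= 4 * M * K by rewrite -mulrA mulr_ge0.
move: dr; rewrite ltr_pdivlMr; last by rewrite ltr_wpDl.
have := normr_ge0 d; nra.
Qed.

End Existence.

(** * Contraction of the range of solutions under covering *)

Section Contraction.
Set Implicit Arguments.
Unset Strict Implicit.
Context (R : realType) (X : finType).
Implicit Types (f g : X -> R) (G : (X -> R) -> X -> R) (u : R -> X -> R).
Implicit Types (x y : X) (a c t M : R) (A P : {set X}).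

(* The bound on P decays at most linearly in the elapsed time and feeds a
   linearly growing bound on the points reached from P. *)
Lemma Phi_reach_bound M G P f a c s : generator M G -> 0 <= M -> 0 <= a ->
  0 <= c -> (forall x, 0 < G (ind R P) x -> c <= G (ind R P) x) ->
  (forall x, 0 <= f x) -> (forall x, x \in P -> a <= f x) ->
  admissible M s -> M * \sum_(d <- s) d <= 1 / 2 ->
  forall x, [/\ 0 <= Phi G s f x,
    x \in P -> a * (1 - M * \sum_(d <- s) d) <= Phi G s f x &
    x \in reach G P -> x \notin P ->
      a * (c / 3) * \sum_(d <- s) d <= Phi G s f x].
Proof.
move=> HG M0 a0 c0 Gc f0 fP; elim/last_ind: s => [|s d IH] sM sum_le x.
  by rewrite big_nil !mulr0 subr0 mulr1; split=> // /fP.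
have [d0 dM] : 0 <= d /\ d * M <= 1 by apply: sM; rewrite mem_rcons mem_head.
have {}sM : admissible M s.
  by move=> e es; apply: sM; rewrite mem_rcons in_cons es orbT.
have S0 : 0 <= \sum_(e <- s) e by rewrite big_seq sumr_ge0 // => e /sM[].
move: sum_le; rewrite -cats1 big_cat big_seq1 cats1 Phi_rcons /=.
move: S0 IH; set S := \sum_(e <- s) e => S0 IH sum_le.
have MS : M * S <= 1 / 2 by nra.
have {}IH := IH sM MS; set g := Phi G s f in IH *.
have g0 y : 0 <= g y by have [] := IH y.
have -> : euler G d g x = (1 - d * M) * g x + d * (M * g x + G g x).
  by rewrite /euler; ring.
have aS : 0 <= a * (1 - M * S) by rewrite mulr_ge0 //; lra.
have gP y : y \in P -> a * (1 - M * S) <= g y by have [_] := IH y.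
have Mg : 0 <= M * g x + G g x.
  have [_ _ /(_ (fun=> 0) g x g0)] := HG.
  by rewrite (generator_cst _ _ HG) mulr0 addr0.
have dMg : 0 <= d * (M * g x + G g x) by rewrite mulr_ge0.
have gx : 0 <= (1 - d * M) * g x by rewrite mulr_ge0 ?subr_ge0.
split; first by rewrite addr_ge0.
  move=> /gP H.
  have : (1 - d * M) * (a * (1 - M * S)) <= (1 - d * M) * g x.
    by rewrite ler_wpM2l // subr_ge0.
  have : 0 <= a * ((d * M) * (M * S)) by rewrite !mulr_ge0.
  lra.
move=> xr xP; have [_ _ /(_ xr xP) H] := IH x.
have Gx : c <= G (ind R P) x.
  by apply: Gc; move: xr; rewrite finset.in_set (negbTE xP).
have := generator_ge_ind x HG aS g0 gP.
rewrite {1}/ind (negbTE xP) mulr0 add0r => H1.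
have H2 : a * (1 - M * S) * c <= M * g x + G g x.
  by apply: le_trans H1; rewrite ler_wpM2l.
have H3 : (1 - d * M) * (a * (c / 3) * S) <= (1 - d * M) * g x.
  by rewrite ler_wpM2l // subr_ge0.
have H4 := ler_wpM2l d0 H2.
(* The slope [c / 3] comes from here: [1 - M S - M S / 3 >= 1 / 3] exactly when [M S <= 1 / 2]. *)
have H5 : 0 <= a * c * d * (1 / 2 - M * S) by rewrite !mulr_ge0 // subr_ge0.
have H6 : 0 <= a * c * d * (M * S) by rewrite !mulr_ge0.
have H7 : 0 <= a * c * d by rewrite !mulr_ge0.
lra.
Qed.

(** The time [1 / (2 M)] is the longest that the bound on Euler steps allows. Minimizing over all
    sets and points makes [b] independent of [P], so that the estimate can be iterated. *)
Lemma solves_reach_bound M G : generator M G -> 0 < M ->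
  exists2 b : R, 0 < b <= 1 & forall P f u a, solves G f u -> 0 <= a ->
    (forall x, 0 <= f x) -> (forall x, x \in P -> a <= f x) ->
    forall x, 0 <= u (2 * M)^-1 x /\
      (x \in reach G P -> b * a <= u (2 * M)^-1 x).
Proof.
move=> HG M0; have M0' := ltW M0.
have [c c0 Gc] := @finite_pos_lower_bound R _
  (fun p : {set X} * X => 0 < G (ind R p.1) p.2) (fun p => G (ind R p.1) p.2)
  (fun _ => id).
(* At time [1 / (2 M)], points of [P] keep [a (1 - 1 / 2)] and newly reached ones have
   [a (c / 3) / (2 M)]. *)
exists (Num.min (1 / 2) (c / (6 * M))).
  rewrite lt_min !divr_gt0 ?mulr_gt0 //=.
  by rewrite ge_min; apply/orP; left; lra.
move=> P f u a Hu a0 f0 fP x.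
set T := (2 * M)^-1; have T0 : 0 <= T by rewrite invr_ge0 mulr_ge0.
have MT : M * T = 1 / 2 by rewrite /T; field; rewrite gt_eqF.
have H s : admissible M s -> \sum_(d <- s) d = T -> _ :=
  fun sM (sT : \sum_(d <- s) d = T) =>
  Phi_reach_bound HG M0' a0 (ltW c0) (fun y => Gc (P, y)) f0 fP sM
    (ltac:(rewrite sT MT; exact: lexx)) x.
split=> [|xr]; apply: (solves_ge HG M0' Hu T0) => s sM sT.
  by have [] := H s sM sT.
have [_] := H s sM sT; rewrite sT MT => H1 H2.
have [xP|xP] := boolP (x \in P).
  apply: le_trans (H1 xP); rewrite mulrC ler_wpM2l // ge_min.
  by apply/orP; left; lra.
apply: le_trans (H2 xr xP); rewrite mulrC -mulrA ler_wpM2l // ge_min.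
apply/orP; right; rewrite le_eqVlt; apply/orP; left; apply/eqP.
by rewrite /T; field; rewrite gt_eqF.
Qed.

Lemma solves_iter_reach_bound M G : generator M G -> 0 < M ->
  exists2 b : R, 0 < b <= 1 & forall n P f u a, solves G f u -> 0 <= a ->
    (forall x, 0 <= f x) -> (forall x, x \in P -> a <= f x) ->
    forall x, x \in iter n (reach G) P ->
      b ^+ n * a <= u (n%:R * (2 * M)^-1) x.
Proof.
move=> HG M0; have [b b01 H] := solves_reach_bound HG M0; exists b => //.
move=> n P f u a Hu a0 f0 fP.
have b0 : 0 <= b by case/andP: b01 => /ltW.
have T0 k : 0 <= k%:R * (2 * M)^-1 by rewrite mulr_ge0 // invr_ge0 mulr_ge0 // ltW.
suff : (forall x, 0 <= u (n%:R * (2 * M)^-1) x) /\ forall x,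
   x \in iter n (reach G) P -> b ^+ n * a <= u (n%:R * (2 * M)^-1) x by case.
elim: n => [|n [IH0 IH]].
  case: Hu => u0 _; rewrite mul0r u0; split=> // x.
  by rewrite expr0 mul1r; exact: fP.
have K := H _ _ _ _ (solves_shift (T0 n) Hu) (mulr_ge0 (exprn_ge0 n b0) a0) IH0 IH.
rewrite -natr1 mulrDl mul1r exprS -mulrA.
by split=> x; have [] := K x.
Qed.

(** Threshold [f] at the midpoint. Spreading of the upper set raises the minimum, spreading of its
    complement under the dual lowers the maximum; if one of the two sets is empty, half of the
    interval is already free. *)
Lemma covering_contraction M G : (0 < #|X|)%N -> generator M G -> 0 < M ->
  covering G -> exists2 q : R, 0 <= q < 1 & exists2 T : R, 0 <= T &
    forall f u lo hi, solves G f u -> (forall x, lo <= f x <= hi) ->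
    exists lo' hi', (forall x, lo' <= u T x <= hi') /\
      hi' - lo' <= q * (hi - lo).
Proof.
move=> /card_gt0P[x0 _] HG M0 cov; have M0' := ltW M0.
have [b1 b1_01 H1] := solves_iter_reach_bound HG M0.
have [b2 b2_01 H2] := solves_iter_reach_bound (generator_dual HG) M0.
set n := #|X|.-1 in cov; set T := n%:R * (2 * M)^-1.
have T0 : 0 <= T by rewrite mulr_ge0 // invr_ge0 mulr_ge0.
have [b1_0 b1_1] := andP b1_01; have [b2_0 b2_1] := andP b2_01.
pose b := Num.min (b1 ^+ n) (b2 ^+ n).
have b0 : 0 < b by rewrite /b lt_min !exprn_gt0.
have bb1 : b <= b1 ^+ n by rewrite /b ge_min lexx.
have bb2 : b <= b2 ^+ n by rewrite /b ge_min lexx orbT.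
have ble1 : b <= 1 by apply: le_trans bb1 _; rewrite exprn_ile1 // ltW.
(* The gain is [b] times half the width; since [b <= 1], this factor also covers the cases where the
   interval is halved. *)
exists (1 - b / 2); first by apply/andP; split; lra.
exists T => // f u lo hi Hu fr.
have w0 : 0 <= hi - lo by have /andP[] := fr x0; lra.
have ur := solves_range HG M0' Hu T0.
have bw : b * (hi - lo) <= hi - lo by nra.
have bw0 : 0 <= b * (hi - lo) by nra.
pose A : {set X} := [set x | (lo + hi) / 2 <= f x].
have [A0|A0] := eqVneq A finset.set0.
  exists lo, ((lo + hi) / 2); split; last by lra.
  apply: ur => x; have /andP[-> _] /= := fr x; rewrite leNgt; apply/negP => fx.
  by have : x \in A; [rewrite finset.in_set ltW|rewrite A0 finset.in_set0].
have [AT|AT] := eqVneq A finset.setT.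
  exists ((lo + hi) / 2), hi; split; last by lra.
  apply: ur => x; have /andP[_ ->] /= := fr x; rewrite andbT.
  by have : x \in A; [rewrite AT finset.in_setT|rewrite finset.in_set].
have a0 : 0 <= (hi - lo) / 2 by lra.
have [c1|c2] := cov A A0 AT.
  exists (lo + b * ((hi - lo) / 2)), hi; split; last by lra.
  move=> x; have /andP[_ ->] := ur lo hi fr x; rewrite andbT.
  have := H1 n A _ _ ((hi - lo) / 2) (solvesD (- lo) HG Hu) a0.
  rewrite c1 => /(_ _ _ x (finset.in_setT x)) /=; rewrite -/T => H.
  have : b * ((hi - lo) / 2) <= b1 ^+ n * ((hi - lo) / 2) by rewrite ler_wpM2r.
  suff : b1 ^+ n * ((hi - lo) / 2) <= u T x - lo by lra.
  apply: H => y; first by have /andP[] := fr y; lra.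
  by rewrite finset.in_set; lra.
exists lo, (hi - b * ((hi - lo) / 2)); split; last by lra.
move=> x; have /andP[-> _] /= := ur lo hi fr x.
have := H2 n (~: A)%SET _ _ ((hi - lo) / 2) (solves_compl hi HG Hu) a0.
rewrite c2 => /(_ _ _ x (finset.in_setT x)) /=; rewrite -/T => H.
have : b * ((hi - lo) / 2) <= b2 ^+ n * ((hi - lo) / 2) by rewrite ler_wpM2r.
suff : b2 ^+ n * ((hi - lo) / 2) <= hi - u T x by lra.
apply: H => y; first by have /andP[] := fr y; lra.
by rewrite finset.in_setC finset.in_set -ltNge; lra.
Qed.

(** Bounds on a solution persist in time and the enclosing intervals shrink geometrically; the limit
    is the supremum of the lower bounds at all times. *)
Lemma covering_converges M G f u : (0 < #|X|)%N -> generator M G -> 0 < M ->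
  covering G -> solves G f u -> exists c : R, forall e : R, 0 < e ->
    exists2 T : R, 0 <= T & forall t, T <= t -> forall x, `|u t x - c| <= e.
Proof.
move=> X0 HG M0 cov Hu; have M0' := ltW M0.
have [q /andP[q0 q1] [T T0 con]] := covering_contraction X0 HG M0 cov.
have [B B0 fB] := finite_bounded f.
have kT0 k : 0 <= k%:R * T by rewrite mulr_ge0.
have ex k : exists lo hi, (forall x, lo <= u (k%:R * T) x <= hi) /\
    hi - lo <= 2 * B * q ^+ k.
  elim: k => [|k [lo [hi [r1 r2]]]].
    exists (- B), B; split; last by rewrite expr0; lra.
    by move=> x; case: Hu => u0 _; rewrite mul0r u0 -ler_norml.
  have [lo' [hi' [r1' r2']]] := con _ _ _ _ (solves_shift (kT0 k) Hu) r1.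
  exists lo', hi'; rewrite -natr1 mulrDl mul1r; split=> //.
  by apply: le_trans r2' _; rewrite exprS mulrCA ler_wpM2l.
have mon t t' lo hi : 0 <= t -> t <= t' -> (forall x, lo <= u t x <= hi) ->
    forall x, lo <= u t' x <= hi.
  move=> t0 tt' r x; have := solves_range HG M0' (solves_shift t0 Hu) _ r x.
  by move=> /(_ (t' - t)); rewrite subr_ge0 addrC subrK; apply.
have [x0 _] := card_gt0P X0.
pose E := [set lo | exists2 t, 0 <= t & forall x, lo <= u t x]%classic.
(* Bounds taken at two different times are both valid at the sum of these times, where they can be
   compared. *)
have Ehi k lo hi : (forall x, lo <= u (k%:R * T) x <= hi) -> ubound E hi.
  move=> r lo' [t t0 Hlo]; pose t' := t + k%:R * T.
  have [_ h1] := andP (mon _ t' _ _ (kT0 k) ltac:(rewrite /t'; lra) r x0).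
  have [K _ uK] := finite_bounded (u t).
  have r' x : lo' <= u t x <= K.
    by rewrite Hlo /=; exact: le_trans (ler_norm _) (uK x).
  have [h2 _] := andP (mon _ t' _ _ t0 ltac:(rewrite /t'; have := kT0 k; lra) r' x0).
  exact: le_trans h1.
exists (sup E) => e e0.
have q_norm : `|q| < 1 by rewrite ger0_norm.
have := @cvg_geometric R (2 * B) q q_norm; move=> /cvgrPdist_le /(_ e e0) /filter_ex.
case=> k; rewrite sub0r normrN /geometric /= => hk.
exists (k%:R * T) => // t kt x.
have [lo [hi [r w]]] := ex k.
have /andP[t1 t2] := mon _ _ _ _ (kT0 k) kt r x.
have Elo : E lo by exists (k%:R * T) => // y; have /andP[] := r y.
have lo_le : lo <= sup E.
  by apply: ub_le_sup => //; exists hi; exact: Ehi r.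
have hi_ge : sup E <= hi by apply: ge_sup; [exists lo|exact: Ehi r].
have := ler_norm (2 * B * q ^+ k).
by rewrite ler_norml => ?; apply/andP; split; lra.
Qed.

End Contraction.

(** * Lower transition rate operators as generators *)

Section RateOperators.
Set Implicit Arguments.
Unset Strict Implicit.
Context (R : realType) (X : finType).
Implicit Types (f g : X -> R) (G Q : (X -> R) -> (X -> R)).
Implicit Types (x y : X) (a c M : R) (A B P : {set X}) (s : seq R).

Definition point x : X -> R := fun y => (y == x)%:R.

Lemma indic1 x : \1_[set x]%classic = point x.
Proof.
apply/funext => y; rewrite indicE /point; congr (_%:R).
by rewrite classical_sets.in_set1.
Qed.

Lemma rate_superadd Q f g x : lower_transition_rate_operator Q ->
  Q f x + Q g x <= Q (fun y => f y + g y) x.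
Proof. by case. Qed.

Lemma rateZ Q c f x : lower_transition_rate_operator Q -> 0 <= c ->
  Q (fun y => c * f y) x = c * Q f x.
Proof.
by case=> _ _ H _ c0; have := congr1 (fun h => h x) (H c f c0).
Qed.

Lemma rate_cst Q c x : lower_transition_rate_operator Q -> Q (fun=> c) x = 0.
Proof. by case=> H _ _ _; have := congr1 (fun h => h x) (H c). Qed.

(** Superadditivity with the constant [c], and again with [- c], gives the two inequalities. *)
Lemma rateD Q c f x : lower_transition_rate_operator Q ->
  Q (fun y => f y + c) x = Q f x.
Proof.
move=> HQ; apply/eqP; rewrite eq_le; apply/andP; split.
  have := rate_superadd (fun y => f y + c) (fun=> - c) x HQ.
  rewrite rate_cst // addr0; congr (_ <= Q _ x).
  by apply/funext => y; rewrite addrK.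
by have := rate_superadd f (fun=> c) x HQ; rewrite rate_cst // addr0.
Qed.

(** Expand [f] in point indicators and use superadditivity; the off-diagonal terms are
    nonnegative. *)
Lemma rate_ge_point Q f x : lower_transition_rate_operator Q ->
  (forall y, 0 <= f y) -> f x * Q (point x) x <= Q f x.
Proof.
move=> HQ f0.
have sumQ (r : seq X) : \sum_(y <- r) f y * Q (point y) x <=
    Q (fun z => \sum_(y <- r) f y * point y z) x.
  elim: r => [|y r IH].
    have -> : (fun z => \sum_(y <- [::]) f y * point y z) = fun=> 0.
      by apply/funext => z; rewrite big_nil.
    by rewrite big_nil rate_cst.
  have -> : (fun z => \sum_(i <- y :: r) f i * point i z) =
      fun z => f y * point y z + \sum_(i <- r) f i * point i z.
    by apply/funext => z; rewrite big_cons.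
  rewrite big_cons; apply: le_trans (rate_superadd _ _ x HQ).
  by rewrite rateZ // lerD2l.
have := sumQ (index_enum X).
have -> : (fun z => \sum_y f y * point y z) = f.
  apply/funext => z; rewrite (bigD1 z) //= /point eqxx mulr1 big1 ?addr0 //.
  by move=> y yz; rewrite eq_sym (negbTE yz) mulr0.
apply: le_trans; rewrite (bigD1 x) //= lerDl sumr_ge0 // => y yx.
rewrite mulr_ge0 //; case: HQ => _ _ _ /(_ y x yx).
by rewrite indic1.
Qed.

(** Superadditivity gives [Q g - Q f >= Q (g - f)], whose value at [x] is at least
    [- M (g x - f x)]. *)
Lemma rate_generator Q M : lower_transition_rate_operator Q ->
  (forall x, - M <= Q (point x) x) -> generator M Q.
Proof.
move=> HQ HM; split=> [c f x c0|c f x|f g x fg]; [exact: rateZ|exact: rateD|].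
have d0 y : 0 <= g y - f y by rewrite subr_ge0.
have := rate_superadd (fun y => g y - f y) f x HQ.
have -> : (fun y => g y - f y + f y) = g by apply/funext => y; rewrite subrK.
have := rate_ge_point x HQ d0.
have : (g x - f x) * - M <= (g x - f x) * Q (point x) x by rewrite ler_wpM2l.
lra.
Qed.

(** The function [2 1_x - 1] has norm 1 and image [2 Q 1_x], whence the factor 1/2. *)
Lemma opnorm_generator Q : (0 < #|X|)%N -> lower_transition_rate_operator Q ->
  generator (opnorm Q / 2) Q /\ 0 <= opnorm Q.
Proof.
move=> X0 HQ; have [x0 _] := card_gt0P X0.
(* A crude constant first, to know that the supremum defining [opnorm] is over a bounded set. *)
have [N N0 HN] := finite_bounded (fun x => Q (point x) x).
have NQ : generator N Q.
  by apply: rate_generator => // x; have := HN x; rewrite ler_norml => /andP[].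
have bnd f : fnorm f = 1 -> fnorm (Q f) <= opnorm Q.
  move=> f1; apply: ub_le_sup; last by exists f.
  exists (2 * N * 1) => _ [g /= g1 <-]; apply: fnorm_le => // x.
  by apply: (generator_bounded x N0 NQ) => y; rewrite -g1 fnorm_ge.
have key x : `|2 * Q (point x) x| <= opnorm Q.
  pose f y : R := 2 * point x y + -1.
  have -> : 2 * Q (point x) x = Q f x by rewrite rateD // rateZ.
  apply: le_trans (fnorm_ge _ _) _; apply: bnd.
  have f1 y : `|f y| = 1.
    rewrite /f /point; case: (y == x); rewrite ?mulr1 ?mulr0 ?add0r ?normrN1 //.
    by rewrite (_ : 2 + -1 = 1) ?normr1 //; ring.
  apply/eqP; rewrite eq_le fnorm_le //= => [|y]; last by rewrite f1.
  by rewrite -(f1 x0) fnorm_ge.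
split; last exact: le_trans (key x0).
by apply: rate_generator => // x; have := key x; rewrite ler_norml; lra.
Qed.

(** Existence guarantees that [xget] returns a solution and not its default value. *)
Lemma lower_semigroup_solves Q f : (0 < #|X|)%N ->
  lower_transition_rate_operator Q ->
  exists2 u, solves Q f u & forall t, lower_semigroup Q t f = u t.
Proof.
move=> X0 HQ; have [HG M0] := opnorm_generator X0 HQ.
exists (xget (fun=> f) [set u | is_solution Q f u]%classic) => //.
apply/(is_solutionP Q f _ X0).
apply: (xgetPex (fun=> f) (P := [set u | is_solution Q f u]%classic)).
have [u /(is_solutionP Q f u X0) Hu] := solves_exists f HG (divr_ge0 M0 (ler0n R 2)).
by exists u.
Qed.


(** * Covering, the coefficient of ergodicity and ergodicity *)

Lemma fvar_ge f x y : f x - f y <= fvar f.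
Proof.
have [K _ fK] := finite_bounded f; apply: lerB.
  apply: ub_le_sup; last by exists x.
  by exists K => _ [z _ <-]; exact: le_trans (ler_norm _) (fK z).
apply: ge_inf; last by exists y.
exists (- K) => _ [z _ <-].
by have := fK z; rewrite ler_norml => /andP[].
Qed.

Lemma fvar_le f c : (0 < #|X|)%N -> (forall x y, f x - f y <= c) -> fvar f <= c.
Proof.
move=> /card_gt0P[x0 _] fc; rewrite lerBlDr.
apply: ge_sup; first by exists (f x0), x0.
move=> _ [x _ <-]; rewrite -lerBlDl.
apply: lb_le_inf; first by exists (f x0), x0.
by move=> _ [y _ <-]; have := fc x y; lra.
Qed.

(** Covering makes either the value at [y] positive or, through the dual, the value at [x] less than
    1. *)
Lemma Phi_ind_var M G s A x y : generator M G -> covering G ->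
  (#|X|.-1 <= size s)%N -> {in s, forall d, 0 < d /\ d * M < 1} ->
  Phi G s (ind R A) x - Phi G s (ind R A) y < 1.
Proof.
move=> HG cov sn sM.
have [A0|A0] := eqVneq A finset.set0.
  have -> : ind R A = fun=> 0.
    by apply/funext => z; rewrite /ind A0 finset.in_set0.
  by rewrite (Phi_cst _ _ HG) subrr.
have [AT|AT] := eqVneq A finset.setT.
  have -> : ind R A = fun=> 1.
    by apply/funext => z; rewrite /ind AT finset.in_setT.
  by rewrite (Phi_cst _ _ HG) subrr.
have sM' : admissible M s by move=> d /sM[d0 dM]; split; apply: ltW.
have r01 := Phi_range HG sM' (@ind01 R X A).
have full H P z : iter #|X|.-1 (reach H) P = finset.setT ->
    z \in iter (size s) (reach H) P.
  move=> E; apply: (fintype.subsetP (iter_reach_subset H P sn)).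
  by rewrite E finset.in_setT.
have pos P z : z \in P -> 0 < ind R P z by rewrite /ind => ->.
have ge0 P z : 0 <= ind R P z by have /andP[] := ind01 R P z.
case: (cov A A0 AT) => /full cA.
  have := Phi_pos HG sM (ge0 A) (pos A) (cA y).
  by have /andP[_] := r01 x; lra.
have := Phi_pos (generator_dual HG) sM (ge0 _) (pos _) (cA x).
rewrite indC (Phi_dual_compl _ _ HG).
by have /andP[] := r01 y; lra.
Qed.

(* A function f with values in [0, 1] is squeezed between 1_A / 2 and
   (1_A + 1) / 2 for A = {f >= 1/2}, which reduces the supremum defining the
   coefficient of ergodicity to finitely many indicators. *)
Lemma ergodicity_coef_lt1 M G s : (0 < #|X|)%N -> generator M G ->
  covering G -> (#|X|.-1 <= size s)%N ->
  {in s, forall d, 0 < d /\ d * M < 1} -> ergodicity_coef (Phi G s) < 1.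
Proof.
move=> X0 HG cov sn sM.
have sM' : admissible M s by move=> d /sM[d0 dM]; split; apply: ltW.
have [a a0 aP] := @finite_pos_lower_bound R _ predT
  (fun p : {set X} * X * X => 1 - (Phi G s (ind R p.1.1) p.1.2 -
     Phi G s (ind R p.1.1) p.2))
  (fun p _ => ltac:(rewrite subr_gt0; exact: (Phi_ind_var _ _ _ HG cov))).
(* [a] is a gap common to all indicators and pairs of points; the squeeze gives
   [(1 - a) / 2 + 1 / 2]. *)
apply: (@le_lt_trans _ _ (1 - a / 2)); last by lra.
apply: ge_sup.
  exists (fvar (Phi G s (fun=> 0))), (fun=> 0) => //= x.
  by rewrite lexx ler01.
move=> _ [f /= f01 <-]; apply: fvar_le => // x y.
pose A : {set X} := [set z | 1 / 2 <= f z].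
have half0 : 0 <= 1 / 2 :> R by lra.
have lo : 1 / 2 * Phi G s (ind R A) y <= Phi G s f y.
  have := congr1 (fun h => h y) (PhiZ s (ind R A) HG half0) => /= <-.
  apply: (Phi_mono HG sM') => z; rewrite /ind finset.in_set.
  by case: (leP (1 / 2) (f z)) => /=; have /andP[] := f01 z; lra.
have hi : Phi G s f x <= 1 / 2 * Phi G s (ind R A) x + 1 / 2.
  have := congr1 (fun h => h x) (PhiZ s (ind R A) HG half0) => /= <-.
  have := congr1 (fun h => h x)
    (PhiD s (1 / 2) (fun z => 1 / 2 * ind R A z) HG) => /= <-.
  apply: (Phi_mono HG sM') => z; rewrite /ind finset.in_set.
  by case: (leP (1 / 2) (f z)) => /=; have /andP[] := f01 z; lra.
by have := aP ((A, x), y) isT; rewrite /=; lra.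
Qed.

Lemma not_coveringP G : ~ covering G -> exists A P B,
  [/\ A \subset P, ~: A \subset B, reach G P = P & reach (dual G) B = B] /\
  exists x y, x \notin P /\ y \notin B.
Proof.
move=> /existsNP[A] /not_implyP[A0] /not_implyP[AT] /not_orP[/eqP N1 /eqP N2].
have AC0 : (~: A)%SET != finset.set0.
  by apply: contra_neq AT => E; rewrite -[A]finset.setCK E finset.setC0.
set P := iter _ _ A in N1; set B := iter _ _ (~: A)%SET in N2.
exists A, P, B; split; first split.
- exact: (iter_reach_subset G A (leq0n _)).
- exact: (iter_reach_subset (dual G) (~: A)%SET (leq0n _)).
- exact: iter_reach_closed.
- exact: iter_reach_closed.
have outside C : C != finset.setT -> exists x : X, x \notin C.
  by rewrite -finset.subTset => /fintype.subsetPn[x _ xC]; exists x.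
by have [x xP] := outside _ N1; have [y yB] := outside _ N2; exists x, y.
Qed.

Lemma ind_sub A B y : A \subset B -> ind R A y <= ind R B y.
Proof.
move=> /fintype.subsetP AB; rewrite /ind.
by case: (boolP (y \in A)) => [/AB ->|_] //; rewrite ler0n.
Qed.

(** The image of [1_A] is trapped below [1_P], and its complement to 1 below [1_B]. The witnesses do
    not depend on [s], so the bounds pass to solutions. *)
Lemma not_covering_Phi M G : generator M G -> ~ covering G ->
  exists A x y, forall s, admissible M s ->
    Phi G s (ind R A) x <= 0 /\ 1 <= Phi G s (ind R A) y.
Proof.
move=> HG /not_coveringP[A [P [B [[AP AB Pcl Bcl] [x [y [xP yB]]]]]]].
exists A, x, y => s sM; split.
  have := Phi_closed HG sM Pcl (fun z => ind_sub z AP) x.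
  by rewrite {2}/ind (negbTE xP).
have := Phi_closed (generator_dual HG) sM Bcl (fun z => ind_sub z AB) y.
rewrite indC (Phi_dual_compl _ _ HG) {2}/ind (negbTE yB).
by rewrite subr_le0.
Qed.

Lemma not_covering_ergodicity_coef M G s : (0 < #|X|)%N -> generator M G ->
  admissible M s -> ~ covering G -> 1 <= ergodicity_coef (Phi G s).
Proof.
move=> X0 HG sM /(not_covering_Phi HG)[A [x [y /(_ s sM)[Hx Hy]]]].
apply: (@le_trans _ _ (fvar (Phi G s (ind R A)))).
  by apply: le_trans (fvar_ge _ y x); lra.
apply: ub_le_sup; last by exists (ind R A) => //= z; exact: ind01.
exists 1 => _ [f /= f01 <-]; apply: fvar_le => // z w.
have /andP[_] := Phi_range HG sM f01 z.
by have /andP[] := Phi_range HG sM f01 w; lra.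
Qed.

Lemma ergodic_coveringP Q : (0 < #|X|)%N ->
  lower_transition_rate_operator Q -> ergodic Q <-> covering Q.
Proof.
move=> X0 HQ; have [HG M0] := opnorm_generator X0 HQ.
have {}M0 : 0 <= opnorm Q / 2 by rewrite divr_ge0.
split=> [erg|cov f].
  apply: contrapT => /(not_covering_Phi HG)[A [x [y H]]].
  have [u Hu uE] := lower_semigroup_solves (ind R A) X0 HQ.
  (* A value at most 0 and a value at least 1 cannot both lie strictly within 1/2 of [c]. *)
  have [c /cvgrPdist_lt /(_ (1 / 2) ltac:(lra))] := erg (ind R A).
  case=> T [Treal HT]; pose t := Num.max 0 (T + 1).
  have t0 : 0 <= t by rewrite /t le_max lexx.
  have Tt : T < t by rewrite /t lt_max; apply/orP; right; lra.
  have := HT t Tt; rewrite /= uE sub0r normrN => /(le_lt_trans (ler_norm _)) Hc.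
  have nx z : `|u t z - c| < 1 / 2.
    by apply: le_lt_trans Hc; exact: (fnorm_ge (u t \- cst c) z).
  have ux : u t x <= 0.
    by apply: (solves_le HG M0 Hu t0) => s /H[].
  have uy : 1 <= u t y.
    by apply: (solves_ge HG M0 Hu t0) => s /H[].
  by have := nx x; have := nx y; rewrite !ltr_norml; lra.
have [u Hu uE] := lower_semigroup_solves f X0 HQ.
(* The contraction estimate requires a positive constant, while [opnorm Q] may be 0. *)
have HG1 : generator (opnorm Q / 2 + 1) Q by apply: generatorW HG; lra.
have [c Hc] := covering_converges X0 HG1 ltac:(lra) cov Hu.
exists c; apply/cvgrPdist_le => e e0; have [T T0 HT] := Hc e e0.
exists T; split; first exact: num_real.
move=> t Tt /=; rewrite sub0r normrN uE ger0_norm.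
  by apply: fnorm_le => // x; apply: HT; exact: ltW.
by have [x0 _] := card_gt0P X0; exact: le_trans (fnorm_ge _ x0).
Qed.

End RateOperators.

Theorem theorem8 (R : realType) (X : finType) (hX : (0 < #|X|)%N)
    (Q : (X -> R) -> (X -> R)) (hQ : lower_transition_rate_operator Q) :
  (ergodic Q <->
     exists n : nat, (n < #|X|)%N /\
       forall k : nat, (n <= k)%N -> (1 <= k)%N ->
       forall d : k.-tuple R,
         (forall i : 'I_k, 0 < tnth d i /\ tnth d i * opnorm Q < 2) ->
         ergodicity_coef (Phi Q d) < 1)
  /\
  (ergodic Q <->
     exists n : nat, (n < #|X|)%N /\
       exists k : nat, [/\ (n <= k)%N, (1 <= k)%N &
       exists d : k.-tuple R,
         (forall i : 'I_k, 0 < tnth d i /\ tnth d i * opnorm Q < 2) /\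
         ergodicity_coef (Phi Q d) < 1]).
Proof.
have [HG M0] := opnorm_generator hX hQ.
have steps k (d : k.-tuple R) :
    (forall i : 'I_k, 0 < tnth d i /\ tnth d i * opnorm Q < 2) ->
    {in (d : seq R), forall e, 0 < e /\ e * (opnorm Q / 2) < 1}.
  by move=> H e /tnthP[i ->]; have [? ?] := H i; split=> //; lra.
rewrite (ergodic_coveringP hX hQ).
have ab : covering Q -> exists n : nat, (n < #|X|)%N /\
    forall k : nat, (n <= k)%N -> (1 <= k)%N -> forall d : k.-tuple R,
      (forall i : 'I_k, 0 < tnth d i /\ tnth d i * opnorm Q < 2) ->
      ergodicity_coef (Phi Q d) < 1.
  move=> cov; exists #|X|.-1; split; first by rewrite prednK.
  move=> k nk _ d /steps dM; apply: (ergodicity_coef_lt1 hX HG cov _ dM).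
  by rewrite size_tuple.
have bc : (exists n : nat, (n < #|X|)%N /\
    forall k : nat, (n <= k)%N -> (1 <= k)%N -> forall d : k.-tuple R,
      (forall i : 'I_k, 0 < tnth d i /\ tnth d i * opnorm Q < 2) ->
      ergodicity_coef (Phi Q d) < 1) ->
  exists n : nat, (n < #|X|)%N /\ exists k : nat, [/\ (n <= k)%N, (1 <= k)%N &
    exists d : k.-tuple R,
      (forall i : 'I_k, 0 < tnth d i /\ tnth d i * opnorm Q < 2) /\
      ergodicity_coef (Phi Q d) < 1].
  (* Taking [n.+1] steps ensures at least one step when [n = 0]. *)
  move=> [n [nX H]]; exists n; split=> //; exists n.+1; split=> //.
  pose e := (opnorm Q + 1)^-1.
  have dP (i : 'I_n.+1) :
      0 < tnth (nseq_tuple n.+1 e) i /\ tnth (nseq_tuple n.+1 e) i * opnorm Q < 2.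
    rewrite (tnth_nth 0) nth_nseq ltn_ord invr_gt0 mulrC.
    by split; [lra|rewrite ltr_pdivrMr; lra].
  by exists (nseq_tuple n.+1 e); split=> //; apply: H.
have ca : (exists n : nat, (n < #|X|)%N /\
    exists k : nat, [/\ (n <= k)%N, (1 <= k)%N & exists d : k.-tuple R,
      (forall i : 'I_k, 0 < tnth d i /\ tnth d i * opnorm Q < 2) /\
      ergodicity_coef (Phi Q d) < 1]) -> covering Q.
  (* Without covering the coefficient is at least 1 for every admissible sequence, so a single value
     below 1 is decisive. *)
  move=> [n [_ [k [_ _ [d [/steps dM]]]]]]; rewrite ltNge => /negP rho.
  apply: contrapT => ncov; apply: rho.
  apply: (not_covering_ergodicity_coef hX HG) => // e /dM[e0 eM].
  by split; apply: ltW.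
by split; split; [exact: ab|move/bc/ca|move/ab/bc|exact: ca].
Qed.
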